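(* For each integer $n \geq 1$, let $Z = [Z_{i,j}]_{1 \leq i,j \leq n}$ be a random matrix whose entries are independent and identically distributed random variables that are positive almost surely, with mean $\nu = \nu(n) = \mathbb{E}Z_{1,1}$ and finite second moment $\delta = \delta(n) = \mathbb{E}Z_{1,1}^2$. Let $1 \leq r_1,\ldots,r_n \leq n$ be deterministic integers (possibly depending on $n$), let $\mathcal{M}$ be the set of all $n \times n$ matrices with entries in $\{0,1\}$ having exactly $r_i$ ones in the $i$-th row for each $1 \leq i \leq n$, and let $X = [X_{i,j}]$ be chosen uniformly at random from $\mathcal{M}$, independently of $Z$. Let $Y = [X_{i,j} Z_{i,j}]_{1 \leq i,j \leq n}$ and $T_n = \mathrm{per}(Y) = \sum_{\sigma} \prod_{i=1}^n Y_{i,\sigma(i)}$, the sum being over all permutations $\sigma$ of $\{1,\ldots,n\}$. Setting $\mu_n := \prod_{i=1}^n r_i \cdot \frac{\nu^n n!}{n^n}$, we have $\mathbb{E}T_n = \mu_n$. Moreover, let $r_{low} = \min_{1 \leq i \leq n} r_i$ and $r_{up} = \max_{1 \leq i \leq n} r_i$. If \[ \sqrt{n}\cdot\frac{\delta}{\nu^2 r_{low}} \longrightarrow 0 \quad\text{and}\quad n\left(\frac{\delta}{\nu^2 r_{low}} - \frac{1}{r_{up}}\right) \longrightarrow 0 \quad \text{as } n \to \infty,\] then \[ \mathbb{E}\left(\frac{T_n}{\mu_n} - 1\right)^2 \longrightarrow 0 \quad \text{as } n \to \infty. \]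
   Context: All quantities ($Z$, its distribution, $\nu$, $\delta$, the integers $r_i$) may depend on $n$; the limits are taken along $n \to \infty$. The permanent of an $n\times n$ matrix $A$ is $\mathrm{per}(A)=\sum_\sigma \prod_{i=1}^n A_{i,\sigma(i)}$ over all permutations $\sigma$ of $\{1,\dots,n\}$. *)

(* Defs.v *)
From HB Require Import structures.
From mathcomp Require Import all_boot all_order all_algebra all_fingroup.
From mathcomp Require Import all_classical all_reals all_analysis.
Set Implicit Arguments. Unset Strict Implicit. Unset Printing Implicit Defensive.
Import Order.TTheory GRing.Theory Num.Theory numFieldNormedType.Exports.
Local Open Scope classical_set_scope.
Local Open Scope ring_scope.

Definition per (R : comRingType) (n : nat) (A : 'M[R]_n) : R :=
  \sum_(s : 'S_n) \prod_(i < n) A i (s i).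

Definition mutually_independent (d : measure_display) (T : measurableType d)
  (R : realType) (P : probability T R) (I : finType) (X : I -> T -> R) : Prop :=
  forall (S : {set I}) (B : I -> set R),
    (forall i, i \in S -> measurable (B i)) ->
    P (\bigcap_(i in [set i | i \in S]) (X i @^-1` B i)) =
    (\prod_(i in S) P (X i @^-1` B i))%E.

Definition identically_distributed (d : measure_display) (T : measurableType d)
  (R : realType) (P : probability T R) (I : Type) (X : I -> T -> R) : Prop :=
  forall i j (B : set R), measurable B -> P (X i @^-1` B) = P (X j @^-1` B).

Definition row_sum_mats (n : nat) (r : 'I_n -> nat) : {set 'M[bool]_n} :=
  [set x : 'M[bool]_n | [forall i, #|[set j | x i j]| == r i]].

Definition hadamard01 (R : realType) (n : nat) (x : 'M[bool]_n)
  (z : 'M[R]_n) : 'M[R]_n := \matrix_(i, j) ((x i j)%:R * z i j).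

Definition rlow (n : nat) (r : 'I_n -> nat) : nat := \big[minn/n]_(i < n) r i.
Definition rup (n : nat) (r : 'I_n -> nat) : nat := \max_(i < n) r i.

Definition mu_n (R : realType) (n : nat) (r : 'I_n -> nat) (nu : R) : R :=
  (\prod_(i < n) (r i)%:R) * (nu ^+ n * n`!%:R / (n%:R ^+ n)).

(* E[ f(X, Z) ] for X uniform on M independent of Z, f >= 0. *)
Definition EXZ (d : measure_display) (T : measurableType d) (R : realType)
  (P : probability T R) (n : nat) (r : 'I_n -> nat)
  (f : 'M[bool]_n -> T -> R) : \bar R :=
  ((#|row_sum_mats r|%:R)^-1%:E *
     \sum_(x in row_sum_mats r) \int[P]_w (f x w)%:E)%E.

(* Main.v *)
(** Since E(T/mu - 1)^2 = E T^2 / mu^2 - 1 >= 0, it suffices to bound E T^2 / mu^2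
    from above by a quantity tending to 1.  By independence of the rows this
    ratio is the average, over a random permutation, of the product of weights
    n delta / (r_i nu^2) at the fixed points i and (1 - 1/r_i) / (1 - 1/n)
    elsewhere.  Put D = delta / (nu^2 r_low).  The weights are at most a = n D and
    b = (1 - 1/r_up) / (1 - 1/n), and expanding b + (a - b) [i fixed] gives for the
    average the value sum_k (a - b)^k b^(n-k) / k! <= b^n exp(a/b - 1), which is at
    most exp(n (D - 1/r_up) + 2 n D^2 + 1/(n-1)).  The two hypotheses say exactly
    that the first two terms of the exponent vanish in the limit. *)
Require Import Defs.
From HB Require Import structures.
From mathcomp Require Import all_boot all_order all_algebra all_fingroup.
From mathcomp Require Import all_classical all_reals all_analysis.
From mathcomp Require Import measurable_realfun.
From mathcomp Require Import ring lra.
Import Order.TTheory GRing.Theory Num.Theory numFieldNormedType.Exports.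
Local Open Scope classical_set_scope.
Local Open Scope ring_scope.

(** * Expectation of products of independent variables *)

Section Independence.
Import HBNNSimple.
Context (d : measure_display) (T : measurableType d) (R : realType)
  (P : probability T R).

(** Linearity: [g] is a finite combination of indicators of its level sets. Factorization is assumed
    only against the single variable [W], so that [W] can later be a whole product of other
    factors. *)
Lemma integral_simple_mul_indep (X W : T -> R) (g : {nnsfun R >-> R}) :
  measurable_fun setT X -> measurable_fun setT W -> (forall w, 0 <= W w) ->
  (forall B, measurable B ->
     \int[P]_w (\1_B (X w) * W w)%:E = P (X @^-1` B) * \int[P]_w (W w)%:E)%E ->
  (\int[P]_w (g (X w) * W w)%:E
   = \int[P]_w (g (X w))%:E * \int[P]_w (W w)%:E)%E.
Proof.
move=> mX mW W0.
set s := finmap.enum_fset (fset_set (range g)).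
pose c y := (y%:E * P (X @^-1` (g @^-1` [set y])))%E.
have mXB B : measurable B -> measurable (X @^-1` B).
  by move=> mB; rewrite -[_ @^-1` _]setTI; exact: mX.
have mg y : measurable (g @^-1` [set y]) by exact: measurable_sfunP.
have s0 (i : 'I_(size s)) : 0 <= s`_i.
  have : s`_i \in s by rewrite mem_nth.
  rewrite /s in_fset_set ?inE; last exact: fimfunP.
  by case=> x _ <-; exact: fun_ge0.
(* Stated for a general [V] because it is used twice: for [W], and for the constant 1, where it
   identifies the sum of the [c] as the mean of [g (X w)]. *)
have key (V : T -> R) : measurable_fun setT V -> (forall w, 0 <= V w) ->
    (forall B, measurable B ->
      \int[P]_w (\1_B (X w) * V w)%:E = P (X @^-1` B) * \int[P]_w (V w)%:E)%E ->
    (\int[P]_w (g (X w) * V w)%:E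
      = (\sum_(i < size s) c s`_i) * \int[P]_w (V w)%:E)%E.
  move=> mV V0 H.
  have mI B : measurable B ->
      measurable_fun setT (fun w => \1_B (X w) * V w : R).
    move=> mB; apply: measurable_funM => //.
    exact: (measurableT_comp (measurable_indic _)).
  have I0 B w : (0 <= (\1_B (X w) * V w)%:E)%E by rewrite lee_fin mulr_ge0.
  transitivity (\int[P]_w \sum_(i < size s)
      (s`_i)%:E * (\1_(g @^-1` [set s`_i]) (X w) * V w)%:E)%E.
    apply: eq_integral => w _; rewrite fimfunEord mulr_suml sumEFin.
    by congr EFin; apply: eq_bigr => i _; rewrite mulrA.
  rewrite ge0_integral_sum//; last 2 first.
  - by move=> i; apply: measurable_funeM; apply/measurable_EFinP; exact: mI.
  - by move=> i w _; apply: mule_ge0 => //; rewrite lee_fin.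
  rewrite ge0_sume_distrl; last first.
    by move=> i _; rewrite /c mule_ge0// lee_fin.
  apply: eq_bigr => i _.
  rewrite ge0_integralZl_EFin//; last by apply/measurable_EFinP; exact: mI.
  by rewrite H// /c muleA.
move=> H; rewrite key//; congr (_ * _)%E; apply/esym.
under eq_integral do rewrite -[g (X _)]mulr1.
rewrite (key (cst 1))//=.
- by rewrite integral_cst//= probability_setT !mule1.
- move=> B mB; rewrite integral_cst//= probability_setT !mule1.
  under eq_integral do rewrite mulr1.
  by rewrite -[X in _ = P X]setIT -integral_indic//; exact: mXB.
Qed.

(** Monotone convergence along simple functions increasing to [f], with and without the factor [W].
    Finiteness of the mean of [W] makes multiplication by it continuous in the extended reals. *)
Lemma integral_mul_indep (X W : T -> R) (f : R -> R) :
  measurable_fun setT X -> measurable_fun setT W -> (forall w, 0 <= W w) ->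
  (\int[P]_w (W w)%:E < +oo)%E ->
  (forall B, measurable B ->
     \int[P]_w (\1_B (X w) * W w)%:E = P (X @^-1` B) * \int[P]_w (W w)%:E)%E ->
  measurable_fun setT f -> (forall x, 0 <= f x) ->
  (\int[P]_w (f (X w) * W w)%:E
   = \int[P]_w (f (X w))%:E * \int[P]_w (W w)%:E)%E.
Proof.
move=> mX mW W0 Woo H mf f0.
have mEf : measurable_fun setT (EFin \o f) by exact/measurable_EFinP.
pose g := nnsfun_approx measurableT mEf.
have gf x : (EFin \o g^~ x) n @[n --> \oo] --> (f x)%:E.
  by apply: (cvg_nnsfun_approx measurableT mEf) => // y _; rewrite lee_fin.
have gX n : measurable_fun setT (fun w => g n (X w)).
  exact: (measurableT_comp (measurable_funPT _) mX).
have lim (V : T -> R) : measurable_fun setT V -> (forall w, 0 <= V w) ->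
    (\int[P]_w (g n (X w) * V w)%:E)%E @[n --> \oo]
      --> (\int[P]_w (f (X w) * V w)%:E)%E.
  move=> mV V0.
  have -> : (\int[P]_w (f (X w) * V w)%:E =
      \int[P]_w limn (fun n => (g n (X w) * V w)%:E))%E.
    apply: eq_integral => w _; apply/esym/cvg_lim => //.
    under eq_fun do rewrite EFinM.
    by rewrite EFinM; apply: cvgeZr => //; exact: gf.
  apply: cvg_monotone_convergence => //.
  - by move=> n; apply/measurable_EFinP/measurable_funM.
  - by move=> n w _; rewrite lee_fin mulr_ge0.
  - move=> w _ a b ab; rewrite lee_fin ler_wpM2r//.
    exact/lefP/nd_nnsfun_approx.
have l1 := lim W mW W0.
have := lim (cst 1) ltac:(by []) ltac:(by []).
under eq_fun do under eq_integral do rewrite mulr1.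
under [X in _ --> X]eq_integral do rewrite mulr1.
move=> l2.
have Wfin : (\int[P]_w (W w)%:E)%E \is a fin_num.
  by rewrite ge0_fin_numE// integral_ge0// => w _; rewrite lee_fin.
have l3 := cvgeZr Wfin l2.
apply: (cvg_unique _ l1) => //=.
rewrite (_ : (fun n => _) = (fun n =>
  \int[P]_w (g n (X w))%:E * \int[P]_w (W w)%:E)%E)//.
by apply/funext => n; exact: integral_simple_mul_indep.
Qed.

(* Independence is the case where every [f i] is an indicator function; the
   induction replaces the indicators by the [f i] one index at a time. *)
Lemma integral_prod_indep (I : finType) (X : I -> T -> R) (f : I -> R -> R) :
  mutually_independent P X -> (forall i, measurable_fun setT (X i)) ->
  (forall i, measurable_fun setT (f i)) -> (forall i x, 0 <= f i x) ->
  (forall i, \int[P]_w (f i (X i w))%:E < +oo)%E ->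
  (\int[P]_w (\prod_i f i (X i w))%:E = \prod_i \int[P]_w (f i (X i w))%:E)%E.
Proof.
move=> indep mX.
have mXB i B : measurable B -> measurable (X i @^-1` B).
  by move=> mB; rewrite -[_ @^-1` _]setTI; exact: mX.
have intI i B : measurable B ->
    (\int[P]_w (\1_B (X i w))%:E = P (X i @^-1` B))%E.
  by move=> mB; rewrite -[X in _ = P X]setIT -integral_indic//; exact: mXB.
suff main (s : seq I) : forall g : I -> R -> R,
    (forall i, i \notin s -> exists2 B, measurable B & g i = \1_B) ->
    (forall i, measurable_fun setT (g i)) -> (forall i x, 0 <= g i x) ->
    (forall i, \int[P]_w (g i (X i w))%:E < +oo)%E ->
    (\int[P]_w (\prod_i g i (X i w))%:E
      = \prod_i \int[P]_w (g i (X i w))%:E)%E.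
  by apply: (main (enum I)) => i; rewrite mem_enum.
elim: s => [|a s IH] g gI mg g0 goo.
  have {}gI i : exists B, measurable B /\ g i = \1_B.
    by have [//|B mB gB] := gI i; exists B.
  have [B BP] := choice gI.
  have mB i : measurable (B i) by case: (BP i).
  have gB i : g i = \1_(B i) by case: (BP i).
  rewrite [RHS](eq_bigr (fun i => P (X i @^-1` B i))); last first.
    by move=> i _; rewrite gB intI.
  pose S := [set: I]%SET.
  have capE : \bigcap_(i in [set i | i \in S]) (X i @^-1` B i) =
      [set w | [forall i, X i w \in B i]].
    apply/seteqP; split => [w h|w /= /forallP h].
      by apply/forallP => i; apply/mem_set; apply: h; rewrite /S /= inE.
    by move=> i _; exact: (set_mem (h i)).
  rewrite [RHS](eq_bigl (mem S)); last by move=> i; rewrite /= /S !inE.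
  rewrite -indep//.
  have mcap : measurable (\bigcap_(i in [set i | i \in S]) (X i @^-1` B i)).
    by apply: fin_bigcap_measurable => // i _; exact: mXB.
  rewrite -[X in _ = P X]setIT -integral_indic//.
  apply: eq_integral => w _; congr EFin.
  rewrite indicE capE; under eq_bigr do rewrite gB indicE.
  have [h|h] := boolP [forall i, X i w \in B i].
    by rewrite mem_set// big1// => i _; rewrite (forallP h).
  rewrite memNset; last exact/negP.
  have /forallPn[i /negbTE wi] := h.
  by rewrite (bigD1 i)//= wi mul0r.
pose W w := \prod_(i | i != a) g i (X i w).
pose c := (\prod_(i | i != a) \int[P]_w (g i (X i w))%:E)%E.
have mgX i : measurable_fun setT (fun w => g i (X i w)).
  exact: measurableT_comp.
have W0 w : 0 <= W w by exact: prodr_ge0.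
have mW : measurable_fun setT W.
  rewrite /W; under eq_fun do rewrite -big_filter.
  by apply: measurable_prod => i _.
(* With the factor at [a] replaced by an indicator, the induction hypothesis for [s] applies. This
   is the factorization required by [integral_mul_indep], and [B = setT] then gives the integral of
   [W]. *)
have H B : measurable B ->
    (\int[P]_w (\1_B (X a w) * W w)%:E = P (X a @^-1` B) * c)%E.
  move=> mB; pose g' i := if i == a then \1_B : R -> R else g i.
  have g'a : g' a = \1_B by rewrite /g' eqxx.
  have g'N i : i != a -> g' i = g i by rewrite /g' => /negbTE ->.
  transitivity (\int[P]_w (\prod_i g' i (X i w))%:E)%E.
    apply: eq_integral => w _; rewrite [in RHS](bigD1 a)//= g'a.
    by congr (_ * _)%:E; apply: eq_bigr => i /g'N ->.
  rewrite IH.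
  - rewrite (bigD1 a)//= g'a intI//; congr (_ * _)%E.
    by apply: eq_bigr => i /g'N ->.
  - move=> i si; have [->|ia] := eqVneq i a; first by exists B; rewrite ?g'a.
    by rewrite g'N//; apply: gI; rewrite inE negb_or ia.
  - by move=> i; rewrite /g'; case: ifP => // _; exact: measurable_indic.
  - by move=> i x; rewrite /g'; case: ifP.
  - move=> i; rewrite /g'; case: ifP => // _.
    by rewrite intI//; rewrite (le_lt_trans (probability_le1 _ _))// ?ltry//; exact: mXB.
have cE : (\int[P]_w (W w)%:E = c)%E.
  have := H setT measurableT; rewrite preimage_setT probability_setT mul1e => <-.
  by apply: eq_integral => w _; rewrite indicT mul1r.
have coo : (c < +oo)%E.
  have fing i : (\int[P]_w (g i (X i w))%:E)%E \is a fin_num.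
    by rewrite ge0_fin_numE// integral_ge0// => w _; rewrite lee_fin.
  rewrite /c; under eq_bigr do rewrite -(fineK (fing _)).
  by rewrite prodEFin ltry.
transitivity (\int[P]_w (g a (X a w) * W w)%:E)%E.
  by apply: eq_integral => w _; rewrite (bigD1 a).
rewrite [RHS](bigD1 a)//= -/c -cE.
by apply: integral_mul_indep => //; rewrite cE.
Qed.

End Independence.

(** * Counting rows and fixed points *)

(** Adjoining [K] is a bijection from the [m]-subsets of the complement of [K]. With [K] a singleton
    or a pair, this counts the rows having ones in one or two prescribed columns. *)
Lemma card_supersets (T : finType) (K : {set T}) m :
  #|[set A : {set T} | (K \subset A) && (#|A| == #|K| + m)%N]%SET|
  = 'C(#|T| - #|K|, m).
Proof.
have <- : #|~: K| = (#|T| - #|K|)%N by rewrite -(cardsC K) addKn.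
rewrite -cards_draws; set D := (X in _ = #|X|).
have injU : {in D &, injective (fun B => K :|: B)}.
  move=> B C; rewrite !inE => /andP[BK _] /andP[CK _] /(congr1 (fun A => A :\: K)).
  rewrite !finset.setDUl finset.setDv !finset.set0U.
  by rewrite !finset.setDE (finset.setIidPl BK) (finset.setIidPl CK).
rewrite -(card_in_imset injU).
apply: eq_card => A; rewrite inE; apply/andP/imsetP => [[KA /eqP Am]|[B]].
  exists (A :\: K).
    rewrite inE finset.setDE finset.subsetIr/= -finset.setDE cardsD.
    by rewrite (finset.setIidPr KA) Am addKn.
  by rewrite -{1}(finset.setID A K) (finset.setIidPr KA).
rewrite inE => /andP[BK /eqP Bm] ->; split; first exact: finset.subsetUl.
rewrite cardsU Bm (_ : K :&: B = finset.set0) ?cards0 ?subn0//.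
by apply/eqP; rewrite finset.setI_eq0 disjoint_sym finset.disjoints_subset.
Qed.

Section RowAverages.
Context (F : numFieldType) (n : nat).

(** A 0-1 matrix with prescribed row sums is a free choice, row by row, of the set of columns
    holding a one; distributivity then factors the sum. *)
Lemma sum_row_sum_mats (r : 'I_n -> nat) (h : 'I_n -> {set 'I_n} -> F) :
  \sum_(x in row_sum_mats r) \prod_i h i [set j | x i j]%SET
  = \prod_i \sum_(A : {set 'I_n} | #|A| == r i) h i A.
Proof.
rewrite bigA_distr_big_dep.
pose phi (x : 'M[bool]_n) : {ffun 'I_n -> {set 'I_n}} :=
  [ffun i => [set j | x i j]%SET].
pose psi (f : {ffun 'I_n -> {set 'I_n}}) : 'M[bool]_n :=
  \matrix_(i, j) (j \in f i).
rewrite (reindex phi); last first.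
  exists psi => [x _|f _].
    by apply/matrixP => i j; rewrite mxE ffunE inE.
  by apply/ffunP => i; apply/setP => j; rewrite ffunE inE mxE.
apply: eq_big => [x|x _]; last by apply: eq_bigr => i _; rewrite ffunE.
have cardE i : #|[set j | x i j]| = #|phi x i|.
  by rewrite ffunE; apply: eq_card => j; rewrite finset.in_set;
    apply/idP/idP => [/set_mem//|xij]; exact: mem_set.
rewrite inE; apply/forallP/familyP => h1 i.
  by rewrite unfold_in -cardE; exact: h1.
by rewrite cardE; exact: h1.
Qed.

(** Probabilistically: the rows of a uniform matrix are independent uniform subsets of sizes [r i].
    The case [h = 1] supplies the normalization. *)
Lemma avg_row_sum_mats (r : 'I_n -> nat) (h : 'I_n -> {set 'I_n} -> F) :
  (#|row_sum_mats r|%:R)^-1 *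
    \sum_(x in row_sum_mats r) \prod_i h i [set j | x i j]%SET
  = \prod_i ((\sum_(A : {set 'I_n} | #|A| == r i) h i A) / 'C(n, r i)%:R).
Proof.
have -> : (#|row_sum_mats r|%:R : F) = \prod_i 'C(n, r i)%:R.
  transitivity (\sum_(x in row_sum_mats r) \prod_(i < n) (1 : F)).
    by rewrite big1_eq sumr_const.
  rewrite (sum_row_sum_mats r (fun _ _ => 1)); apply: eq_bigr => i _.
  by rewrite sumr_const -[in RHS](card_ord n) -card_draws cardsE.
by rewrite sum_row_sum_mats mulrC -prodfV -big_split.
Qed.

Lemma avg_mem (r : nat) (j : 'I_n) : (1 <= r <= n)%N ->
  (\sum_(A : {set 'I_n} | #|A| == r) (j \in A)%:R) / 'C(n, r)%:R
  = r%:R / n%:R :> F.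
Proof.
case: r => // r /andP[_ rn].
have n0 : n%:R != 0 :> F by rewrite pnatr_eq0 -lt0n (leq_ltn_trans _ rn).
have C0 : 'C(n, r.+1)%:R != 0 :> F by rewrite pnatr_eq0 -lt0n bin_gt0.
apply/eqP; rewrite eqr_div// -natr_sum -!natrM eqr_nat; apply/eqP.
rewrite -mul_bin_diag mulnC; congr (_ * _)%N.
have := @card_supersets 'I_n [set j]%SET r.
rewrite cards1 card_ord subn1 => <-.
rewrite -sum1_card big_mkcond [RHS]big_mkcond/=; apply: eq_bigr => A _.
by rewrite inE finset.sub1set add1n; case: (j \in A); case: (#|A| == r.+1).
Qed.

Lemma avg_mem2 (r : nat) (j k : 'I_n) : j != k -> (1 <= r <= n)%N ->
  (\sum_(A : {set 'I_n} | #|A| == r) ((j \in A)%:R * (k \in A)%:R))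
    / 'C(n, r)%:R
  = r%:R * (r%:R - 1) / (n%:R * (n%:R - 1)) :> F.
Proof.
move=> jk /andP[r1 rn].
have n1 : (1 < n)%N.
  have : (#|[set j; k]%SET| <= #|'I_n|)%N by apply: max_card.
  by rewrite cards2 jk card_ord.
have nB1 : n%:R - 1 = n.-1%:R :> F by rewrite -subn1 natrB// ltnW.
have rB1 : r%:R - 1 = r.-1%:R :> F by rewrite -subn1 natrB.
have C0 : 'C(n, r)%:R != 0 :> F by rewrite pnatr_eq0 -lt0n bin_gt0.
rewrite nB1 rB1; apply/eqP; rewrite eqr_div//; last first.
  by rewrite -natrM pnatr_eq0 -lt0n muln_gt0 -subn1 subn_gt0 n1 andbT ltnW.
under eq_bigr do rewrite -natrM.
rewrite -natr_sum -!natrM eqr_nat; apply/eqP.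
(* For [r = 1] both sides vanish, since no singleton contains two distinct columns. Otherwise the
   absorption identity for binomials is applied twice. *)
case: r r1 rn C0 {rB1} => // -[|r] _ rn C0 /=.
  rewrite muln0 mul0n big1 ?mul0n// => A /cards1P[a ->].
  by rewrite !inE; case: eqP => // <-; rewrite eq_sym (negbTE jk).
have -> : (r.+2 * r.+1 * 'C(n, r.+2) = n * (n.-1 * 'C(n.-2, r)))%N.
  by rewrite mul_bin_diag mulnCA mul_bin_diag mulnCA mulnA.
rewrite mulnC -mulnA; congr (_ * (_ * _))%N.
have := @card_supersets 'I_n [set j; k]%SET r.
rewrite cards2 jk card_ord subn2 => <-.
rewrite -sum1_card big_mkcond [RHS]big_mkcond/=; apply: eq_bigr => A _.
rewrite inE finset.subUset !finset.sub1set.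
by case: (j \in A); case: (k \in A); case: (#|A| == r.+2).
Qed.

End RowAverages.

Lemma sum_perm_fixed_points (F : numFieldType) (n : nat) (a b : F) :
  \sum_(s : 'S_n) \prod_i (if s i == i then a else b)
  = n`!%:R * \sum_(k < n.+1) (a - b) ^+ k * b ^+ (n - k) / k`!%:R.
Proof.
transitivity (\sum_(J : {set 'I_n})
    (a - b) ^+ #|J| * b ^+ (n - #|J|) * (n - #|J|)`!%:R).
  have -> : \sum_(s : 'S_n) \prod_i (if s i == i then a else b) =
      \sum_(s : 'S_n) \sum_(J : {set 'I_n})
        (if J \subset [set i | s i == i]%SET
         then (a - b) ^+ #|J| * b ^+ (n - #|J|) else 0).
    apply: eq_bigr => s _.
    under eq_bigr => i _.
      rewrite (_ : (if _ then _ else _) = (if s i == i then a - b else 0) + b).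
        over.
      by case: eqP; rewrite ?subrK ?add0r.
    rewrite bigA_distr; apply: eq_bigr => J _.
    rewrite (bigID (mem J))/=.
    rewrite (eq_bigr (fun i => if s i == i then a - b else 0)); last first.
      by move=> i ->.
    rewrite [X in _ * X](eq_bigr (fun=> b)); last by move=> i /negbTE ->.
    rewrite [X in _ * X](eq_bigl (fun i => i \in ~: J)); last by move=> i; rewrite inE.
    rewrite prodr_const cardsCs finset.setCK card_ord.
    case: ifPn => [Js|/fintype.subsetPn[i iJ]].
      rewrite (eq_bigr (fun=> a - b)) ?prodr_const// => i /(fintype.subsetP Js).
      by rewrite inE => ->.
    by rewrite inE => /negbTE si; rewrite (bigD1 i)//= si !mul0r.
  rewrite exchange_big; apply: eq_bigr => J _.
  rewrite -big_mkcond sumr_const/= -[LHS]mulr_natr; congr (_ * _%:R).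
  (* A permutation fixing [J] pointwise is one supported on the complement of [J], which gives the
     factorial of [n - #|J|]. *)
  rewrite -[X in (X - _)%N](card_ord n) -(cardsC J) addKn -card_perm.
  apply: eq_card => s; rewrite !unfold_in /=.
  apply/fintype.subsetP/fintype.subsetP => h i.
    by apply: contraR => /=; rewrite !inE negbK => /h; rewrite inE.
  move=> iJ; rewrite inE; apply: contraTT iJ => si.
  by have := h i si; rewrite inE.
(* The summand depends only on the size [k] of [J], and ['C(n, k)] times [(n - k)!] is [n! / k!]. *)
rewrite (partition_big (fun J : {set 'I_n} => inord #|J| : 'I_n.+1) xpredT)//=.
rewrite mulr_sumr; apply: eq_bigr => k _.
have cardJ (J : {set 'I_n}) : (inord #|J| == k) = (#|J| == k).
  rewrite -val_eqE/= inordK// ltnS -[X in (_ <= X)%N](card_ord n).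
  exact: max_card.
under eq_bigl do rewrite cardJ.
rewrite (eq_bigr (fun=> (a - b) ^+ k * b ^+ (n - k) * (n - k)`!%:R)); last first.
  by move=> J /eqP ->.
rewrite sumr_const.
have -> : #|[pred J : {set 'I_n} | #|J| == k]| = 'C(n, k).
  transitivity #|[set J : {set 'I_n} | #|J| == k]%SET|; first by rewrite cardsE.
  by rewrite card_draws card_ord.
have kn : (k <= n)%N by rewrite -ltnS.
have k0 : k`!%:R != 0 :> F by rewrite pnatr_eq0 -lt0n fact_gt0.
rewrite -[LHS]mulr_natr -[in RHS](bin_fact kn) !natrM.
by move: ((a - b) ^+ k) (b ^+ (n - k)) => X Y; field.
Qed.

(** * Moments of the permanent *)

Lemma mu_nE (R : realType) (n : nat) (r : 'I_n -> nat) (nu : R) :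
  mu_n r nu = n`!%:R * \prod_i ((r i)%:R / n%:R * nu).
Proof.
by rewrite !big_split/= prodfV !prodr_const card_ord /mu_n; ring.
Qed.

Lemma integral_sqr_normalized (d : measure_display) (T : measurableType d)
  (R : realType) (P : probability T R) (f : T -> R) (c a b : R) :
  measurable_fun setT f -> (forall w, 0 <= f w) -> 0 < c ->
  (\int[P]_w (f w)%:E = a%:E)%E -> (\int[P]_w (f w ^+ 2)%:E = b%:E)%E ->
  (\int[P]_w ((f w / c - 1) ^+ 2)%:E = (b / c ^+ 2 - 2 / c * a + 1)%:E)%E.
Proof.
move=> mf f0 c0 fa fb.
have c1 : c != 0 by rewrite gt_eqF.
have k0 : 0 <= 2 / c by rewrite divr_ge0// ltW.
have k1 : 0 <= (c ^+ 2)^-1 by rewrite invr_ge0 sqr_ge0.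
have mEf : measurable_fun setT (fun w => (f w)%:E) by exact/measurable_EFinP.
have mEf2 : measurable_fun setT (fun w => (f w ^+ 2)%:E).
  by apply/measurable_EFinP; exact: measurable_funX.
have mI : measurable_fun setT (fun w => ((f w / c - 1) ^+ 2)%:E).
  apply/measurable_EFinP; apply: measurable_funX; apply: measurable_funB => //.
  exact: measurable_funM.
(* The cross term of the square is moved to the left, so that only integrals of non-negative
   functions are added; it is subtracted back at the end as a finite number. *)
have E : (\int[P]_w ((f w / c - 1) ^+ 2)%:E + (2 / c * a)%:E
    = (b / c ^+ 2 + 1)%:E)%E.
  have -> : (2 / c * a)%:E = (\int[P]_w ((2 / c)%:E * (f w)%:E))%E.
    rewrite ge0_integralZl_EFin ?fa//.
    by move=> w _; rewrite lee_fin.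
  rewrite -ge0_integralD//; last 3 first.
  - by move=> w _; rewrite lee_fin sqr_ge0.
  - by move=> w _; rewrite mule_ge0// lee_fin.
  - exact: measurable_funeM.
  transitivity (\int[P]_w ((c ^- 2)%:E * (f w ^+ 2)%:E + 1))%E.
    by apply: eq_integral => w _; rewrite -!EFinM -!EFinD; congr EFin; field.
  rewrite ge0_integralD//; last 2 first.
  - by move=> w _; rewrite mule_ge0// lee_fin// sqr_ge0.
  - exact: measurable_funeM.
  rewrite ge0_integralZl_EFin ?fb//; last first.
    by move=> w _; rewrite lee_fin sqr_ge0.
  by rewrite integral_cst//= probability_setT mul1e -EFinM -EFinD mulrC.
transitivity ((b / c ^+ 2 + 1)%:E - (2 / c * a)%:E)%E; first by rewrite -E addeK.
by rewrite -EFinB addrAC.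
Qed.

Section PermanentMoments.
Context (d : measure_display) (T : measurableType d) (R : realType)
  (P : probability T R) (n : nat) (r : 'I_n -> nat).
Hypothesis rn : forall i, (1 <= r i <= n)%N.

Lemma EXZ_EFin (f : 'M[bool]_n -> T -> R) (g : 'M[bool]_n -> R) :
  (forall x, \int[P]_w (f x w)%:E = (g x)%:E)%E ->
  EXZ P r f
  = ((#|row_sum_mats r|%:R)^-1 * \sum_(x in row_sum_mats r) g x)%:E.
Proof.
move=> fg; rewrite /EXZ; under eq_bigr do rewrite fg.
by rewrite sumEFin.
Qed.

Variables (A : 'I_n -> 'I_n -> T -> R) (nu delta : R).
Hypothesis A0 : forall i j w, 0 <= A i j w.
Hypothesis mA : forall i j, measurable_fun setT (A i j).
(** The moment of order [k] for [k <= 2], order 2 being the default value of [nth]. Higher orders do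
    not arise: two permutations together use an entry at most twice. *)
Let mom (k : nat) : R := nth delta [:: 1; nu] k.
Hypothesis momA : forall e : 'I_n -> 'I_n -> nat,
  (forall i j, (e i j <= 2)%N) ->
  (\int[P]_w (\prod_i \prod_j A i j w ^+ e i j)%:E
   = (\prod_i \prod_j mom (e i j))%:E)%E.

Let perA (x : 'M[bool]_n) (w : T) : R :=
  per (hadamard01 x (\matrix_(i, j) A i j w)).

Let mterm (s : 'S_n) (x : 'M[bool]_n) :
  measurable_fun setT (fun w => \prod_i ((x i (s i))%:R * A i (s i) w)).
Proof.
by apply: measurable_prod => i _; apply: measurable_funM.
Qed.

Let term0 (s : 'S_n) (x : 'M[bool]_n) w :
  0 <= \prod_i ((x i (s i))%:R * A i (s i) w).
Proof. by apply: prodr_ge0 => i _; rewrite mulr_ge0. Qed.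

Let perAE x w : perA x w = \sum_(s : 'S_n) \prod_i ((x i (s i))%:R * A i (s i) w).
Proof. by apply: eq_bigr => s _; apply: eq_bigr => i _; rewrite !mxE. Qed.

Lemma integral_scaled_moments (c : R) (e : 'I_n -> 'I_n -> nat) :
  0 <= c -> (forall i j, (e i j <= 2)%N) ->
  (\int[P]_w (c * \prod_i \prod_j A i j w ^+ e i j)%:E
   = (c * \prod_i \prod_j mom (e i j))%:E)%E.
Proof.
move=> c0 e2; under eq_integral do rewrite EFinM.
rewrite ge0_integralZl_EFin// ?momA//.
  move=> w _; rewrite lee_fin prodr_ge0// => i _.
  by rewrite prodr_ge0// => j _; rewrite exprn_ge0.
apply/measurable_EFinP; apply: measurable_prod => i _.
by apply: measurable_prod => j _; exact: measurable_funX.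
Qed.

Lemma integral_term (s : 'S_n) (x : 'M[bool]_n) :
  (\int[P]_w (\prod_i ((x i (s i))%:R * A i (s i) w))%:E
   = (\prod_i ((x i (s i))%:R * nu))%:E)%E.
Proof.
pose e (i j : 'I_n) : nat := (j == s i).
transitivity (\int[P]_w (\prod_i (x i (s i))%:R *
    \prod_i \prod_j A i j w ^+ e i j)%:E)%E.
  apply: eq_integral => w _; rewrite big_split/=; congr (_ * _)%:E.
  apply: eq_bigr => i _; rewrite (bigD1 (s i))//= /e eqxx expr1 big1 ?mulr1//.
  by move=> j /negbTE ->.
rewrite integral_scaled_moments//; last 2 first.
- by apply: prodr_ge0.
- by move=> i j; rewrite /e; case: eqP.
rewrite -big_split/=; congr EFin; apply: eq_bigr => i _; congr (_ * _).
rewrite (bigD1 (s i))//= /e eqxx big1 ?mulr1//.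
by move=> j /negbTE ->.
Qed.

Lemma integral_term2 (s t : 'S_n) (x : 'M[bool]_n) :
  (\int[P]_w (\prod_i ((x i (s i))%:R * A i (s i) w) *
              \prod_i ((x i (t i))%:R * A i (t i) w))%:E
   = (\prod_i ((x i (s i))%:R * (x i (t i))%:R *
               (if s i == t i then delta else nu ^+ 2)))%:E)%E.
Proof.
pose e (i j : 'I_n) : nat := ((j == s i) + (j == t i))%N.
transitivity (\int[P]_w (\prod_i ((x i (s i))%:R * (x i (t i))%:R) *
    \prod_i \prod_j A i j w ^+ e i j)%:E)%E.
  apply: eq_integral => w _.
  rewrite -!big_split/=; congr EFin; apply: eq_bigr => i _.
  rewrite mulrACA; congr (_ * _).
  under eq_bigr do rewrite /e exprD.
  rewrite big_split/= (bigD1 (s i))//= eqxx expr1 big1 ?mulr1; last first.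
    by move=> j /negbTE ->.
  rewrite (bigD1 (t i))//= eqxx expr1 big1 ?mulr1//.
  by move=> j /negbTE ->.
rewrite integral_scaled_moments//; last 2 first.
- by apply: prodr_ge0 => i _; rewrite mulr_ge0.
- by move=> i j; rewrite /e; do 2 case: eqP.
rewrite -big_split/=; congr EFin; apply: eq_bigr => i _; congr (_ * _).
(* If the permutations agree at [i], one entry of the row occurs squared; otherwise two distinct
   entries occur once each. *)
have [st|st] := eqVneq (s i) (t i).
  rewrite (bigD1 (s i))//= /e st eqxx big1 ?mulr1//.
  by move=> j /negbTE ->.
rewrite (bigD1 (s i))//= (bigD1 (t i)) 1?eq_sym//= /e !eqxx (negbTE st).
rewrite eq_sym (negbTE st) big1 ?mulr1//.
by move=> j /andP[/negbTE -> /negbTE ->].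
Qed.

Lemma measurable_per x : measurable_fun setT (perA x).
Proof.
by rewrite (funext (perAE x)); exact: measurable_sum.
Qed.

Lemma per_ge0 x w : 0 <= perA x w.
Proof. by rewrite perAE sumr_ge0. Qed.

Let G1 (x : 'M[bool]_n) : R := \sum_(s : 'S_n) \prod_i ((x i (s i))%:R * nu).

Let G2 (x : 'M[bool]_n) : R := \sum_(s : 'S_n) \sum_(t : 'S_n) \prod_i
  ((x i (s i))%:R * (x i (t i))%:R * (if s i == t i then delta else nu ^+ 2)).

Let avg (g : 'M[bool]_n -> R) : R :=
  (#|row_sum_mats r|%:R)^-1 * \sum_(x in row_sum_mats r) g x.

(* The mean of [Y i (s i) * Y i (t i)], where [b] says whether [s i = t i]. *)
Definition sqr_weight (i : 'I_n) (b : bool) : R :=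
  if b then (r i)%:R / n%:R * delta
  else (r i)%:R * ((r i)%:R - 1) / (n%:R * (n%:R - 1)) * nu ^+ 2.

Let avg_G1 : avg G1 = \sum_(s : 'S_n) \prod_i ((r i)%:R / n%:R * nu).
Proof.
rewrite /avg exchange_big mulr_sumr; apply: eq_bigr => s _.
pose h i (B : {set 'I_n}) : R := (s i \in B)%:R * nu.
rewrite (eq_bigr (fun x : 'M[bool]_n => \prod_i h i [set j | x i j]%SET)); last first.
  by move=> x _; apply: eq_bigr => i _; rewrite /h inE.
rewrite avg_row_sum_mats; apply: eq_bigr => i _.
by rewrite -mulr_suml mulrAC avg_mem.
Qed.

Let avg_G2 : avg G2 =
  \sum_(s : 'S_n) \sum_(t : 'S_n) \prod_i sqr_weight i (s i == t i).
Proof.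
rewrite /avg exchange_big mulr_sumr; apply: eq_bigr => s _.
rewrite exchange_big mulr_sumr; apply: eq_bigr => t _.
pose h i (B : {set 'I_n}) : R := (s i \in B)%:R * (t i \in B)%:R *
   (if s i == t i then delta else nu ^+ 2).
rewrite (eq_bigr (fun x : 'M[bool]_n => \prod_i h i [set j | x i j]%SET)); last first.
  by move=> x _; apply: eq_bigr => i _; rewrite /h !inE.
rewrite avg_row_sum_mats; apply: eq_bigr => i _.
rewrite -mulr_suml mulrAC /sqr_weight; have [st|st] := eqVneq; last by rewrite avg_mem2.
congr (_ * _); rewrite -(avg_mem R n _ (s i) (rn i)); congr (_ / _).
(* When [s i = t i] the two membership indicators coincide, and an indicator equals its square. *)
by apply: eq_bigr => B _; rewrite -st -natrM mulnb andbb.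
Qed.

(** This amounts to [row_sum_mats r] being nonempty, which holds because each [r i] is at most
    [n]. *)
Let avg1 : avg (fun=> 1) = 1.
Proof.
have := avg_row_sum_mats R n r (fun _ _ => 1).
rewrite big1_eq => H; rewrite /avg H big1// => i _.
rewrite sumr_const -[n in 'C(n, _)](card_ord n) -card_draws cardsE divff//.
rewrite -(cardsE (fun A : {set 'I_n} => #|A| == r i)) card_draws card_ord.
by rewrite pnatr_eq0 -lt0n bin_gt0; case/andP: (rn i).
Qed.

Let integral_per x : (\int[P]_w (perA x w)%:E = (G1 x)%:E)%E.
Proof.
under eq_integral do rewrite perAE -sumEFin.
rewrite ge0_integral_sum//.
- by under eq_bigr do rewrite integral_term; rewrite sumEFin.
- by move=> s; apply/measurable_EFinP.
- by move=> s w _; rewrite lee_fin.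
Qed.

Let integral_per_sqr x : (\int[P]_w (perA x w ^+ 2)%:E = (G2 x)%:E)%E.
Proof.
under eq_integral do rewrite perAE expr2 mulr_suml -sumEFin.
rewrite ge0_integral_sum//; last 2 first.
- move=> s; apply/measurable_EFinP; apply: measurable_funM => //.
  exact: measurable_sum.
- by move=> s w _; rewrite lee_fin mulr_ge0// sumr_ge0.
rewrite -sumEFin; apply: eq_bigr => s _.
under eq_integral do rewrite mulr_sumr -sumEFin.
rewrite ge0_integral_sum//; last 2 first.
- by move=> t; apply/measurable_EFinP; apply: measurable_funM.
- by move=> t w _; rewrite lee_fin mulr_ge0.
by rewrite -sumEFin; apply: eq_bigr => t _; rewrite integral_term2.
Qed.

Let nperm_sum : \sum_(s : 'S_n) \prod_i ((r i)%:R / n%:R * nu) = mu_n r nu.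
Proof.
by rewrite mu_nE sumr_const -/(#|'S_n|) card_Sn mulr_natl.
Qed.

Lemma expectation_per : EXZ P r perA = (mu_n r nu)%:E.
Proof. by rewrite (EXZ_EFin _ _ integral_per) -/(avg G1) avg_G1 nperm_sum. Qed.

Lemma expectation_normalized_per :
  0 < mu_n r nu ->
  EXZ P r (fun x w => (perA x w / mu_n r nu - 1) ^+ 2) =
  ((\sum_(s : 'S_n) \sum_(t : 'S_n) \prod_i sqr_weight i (s i == t i))
    / mu_n r nu ^+ 2 - 1)%:E.
Proof.
set m := mu_n r nu => mp; have m0 : m != 0 by rewrite gt_eqF.
pose V x := G2 x / m ^+ 2 - 2 / m * G1 x + 1.
rewrite (EXZ_EFin _ V); last first.
  move=> x; rewrite /V.
  apply: integral_sqr_normalized => //; [exact: measurable_per|exact: per_ge0].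
rewrite -/(avg V); congr EFin; rewrite -avg_G2.
have -> : avg V = avg G2 / m ^+ 2 - 2 / m * avg G1 + avg (fun=> 1).
  rewrite /avg /V !big_split/= sumrN -mulr_sumr -mulr_suml; ring.
by rewrite avg_G1 nperm_sum -/m avg1; field.
Qed.

End PermanentMoments.

(** * Bounding the second moment *)

Lemma exp_partial_sum_le (R : realType) (x : R) (n : nat) :
  0 <= x -> \sum_(k < n) x ^+ k / k`!%:R <= expR x.
Proof.
move=> x0.
have -> : \sum_(k < n) x ^+ k / k`!%:R = series (exp_coeff x) n.
  by rewrite /series/= big_mkord.
apply: nondecreasing_cvgn_le; last exact: is_cvg_series_exp_coeff.
apply/nondecreasing_seqP => k; rewrite seriesSr lerDl.
by rewrite divr_ge0// exprn_ge0.
Qed.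

Lemma sum_perm_fixed_points_le (R : realType) (n : nat) (a b : R) :
  0 < b -> b <= a ->
  \sum_(s : 'S_n) \prod_i (if s i == i then a else b)
  <= n`!%:R * (b ^+ n * expR (a / b - 1)).
Proof.
move=> b0 ba; rewrite sum_perm_fixed_points ler_wpM2l//.
have -> : \sum_(k < n.+1) (a - b) ^+ k * b ^+ (n - k) / k`!%:R =
    b ^+ n * \sum_(k < n.+1) (a / b - 1) ^+ k / k`!%:R.
  rewrite mulr_sumr; apply: eq_bigr => k _.
  have kn : (k <= n)%N by rewrite -ltnS.
  rewrite mulrA; congr (_ / _).
  rewrite -[n in b ^+ n * _](subnK kn) exprD -mulrA -exprMn mulrBr mulr1 mulrCA divff ?mulr1.
    by rewrite mulrC.
  by rewrite gt_eqF.
apply: ler_wpM2l; first by rewrite exprn_ge0// ltW.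
(* The assumption [b <= a] makes [a / b - 1] non-negative, so the partial sums increase to the
   exponential. *)
by apply: exp_partial_sum_le; rewrite subr_ge0 ler_pdivlMr// mul1r.
Qed.

(* With [a = n D] and [b = (1 - v) / (1 - 1/n)], use
   [1 + t <= exp t] on both factors of [b] and [1 <= (1 + 2 D) (1 - v)]. *)
Lemma weight_exp_bound (R : realType) (n : nat) (D v b : R) :
  (2 <= n)%N -> 0 < v -> v <= D -> D <= 1 / 2 ->
  b = (1 - v) * (n%:R / (n%:R - 1)) ->
  b ^+ n * expR (n%:R * D / b - 1)
  <= expR (n%:R * (D - v) + 2 * n%:R * D ^+ 2 + (n%:R - 1)^-1).
Proof.
move=> n2 v0 vD D2; set N : R := n%:R.
have N2 : 2 <= N by rewrite /N (ler_nat _ 2).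
have N1 : 0 < N - 1 by lra.
move=> bE0.
have b0 : 0 < b by rewrite bE0 mulr_gt0 ?divr_gt0//; lra.
have bE : b <= expR (- v + (N - 1)^-1).
  rewrite bE0 expRD; apply: ler_pM.
  - lra.
  - by rewrite divr_ge0//; lra.
  - by rewrite (le_trans _ (expR_ge1Dx _)).
  - rewrite (le_trans _ (expR_ge1Dx _))//.
    rewrite le_eqVlt; apply/orP; left; apply/eqP; field; lra.
have bn : b ^+ n <= expR (N * (- v + (N - 1)^-1)).
  by rewrite expRM_natl lerXn2r ?nnegrE ?expR_ge0// ltW.
have DB : N * D / b <= N * D + 2 * N * D ^+ 2 .
  rewrite ler_pdivrMr// bE0.
  have -> : (N * D + 2 * N * D ^+ 2) * ((1 - v) * (N / (N - 1))) =
    (N * D) * ((1 + 2 * D) * (1 - v) * (N / (N - 1))) by ring.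
  rewrite ler_peMr//; first by rewrite mulr_ge0//; lra.
  have h1 : 1 <= N / (N - 1) by rewrite ler_pdivlMr//; lra.
  (* Since [v <= D], the product is at least [(1 + 2 * D) * (1 - D) = 1 + D * (1 - 2 * D)], and
     [D <= 1 / 2]. *)
  have h2 : 1 <= (1 + 2 * D) * (1 - v) by nra.
  by rewrite mulr_ege1.
have e2 : expR (N * D / b - 1) <= expR (N * D + 2 * N * D ^+ 2 - 1).
  by rewrite ler_expR lerD2r.
apply: (le_trans (ler_pM _ (expR_ge0 _) bn e2)).
  by rewrite exprn_ge0// ltW.
rewrite -expRD ler_expR.
(* The 1 split off here cancels the [- 1] in the exponent [N * D / b - 1]. *)
have : N * (N - 1)^-1 = 1 + (N - 1)^-1 by field; lra.
move=> h; rewrite mulrDr h; lra.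
Qed.

Lemma rlow_le (n : nat) (r : 'I_n -> nat) (i : 'I_n) : (rlow r <= r i)%N.
Proof.
rewrite /rlow; have : i \in index_enum 'I_n by rewrite mem_index_enum.
elim: (index_enum _) => // j s IH; rewrite inE big_cons geq_min.
by case/orP => [/eqP <-|/IH ->]; rewrite ?leqnn ?orbT.
Qed.

Lemma rlow_gt0 (n : nat) (r : 'I_n -> nat) :
  (0 < n)%N -> (forall i, 0 < r i)%N -> (0 < rlow r)%N.
Proof.
move=> n0 r0; rewrite /rlow; elim/big_rec: _ => // i x _ x0.
by rewrite leq_min r0.
Qed.

Lemma rlow_le_rup (n : nat) (r : 'I_n -> nat) :
  (0 < n)%N -> (rlow r <= rup r)%N.
Proof.
case: n r => // n r _; rewrite (leq_trans (rlow_le _ _ ord0))//.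
exact: leq_bigmax.
Qed.

Section SecondMomentBound.
Context (R : realType) (n : nat) (r : 'I_n -> nat) (nu delta : R).
Hypotheses (n2 : (2 <= n)%N) (rn : forall i, (1 <= r i <= n)%N).
Hypotheses (nu0 : 0 < nu) (nud : nu ^+ 2 <= delta).
Let D := delta / (nu ^+ 2 * (rlow r)%:R).
Let v : R := ((rup r)%:R)^-1.
Hypothesis D2 : D <= 1 / 2.
Let N : R := n%:R.
Let b := (1 - v) * (N / (N - 1)).

Let n0 : (0 < n)%N. Proof. exact: leq_trans n2. Qed.
Let N2 : 2 <= N. Proof. by rewrite /N (ler_nat _ 2). Qed.
Let rl0 : 0 < (rlow r)%:R :> R.
Proof. by rewrite ltr0n rlow_gt0// => i; case/andP: (rn i). Qed.
Let ru0 : 0 < (rup r)%:R :> R.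
Proof. by rewrite (lt_le_trans rl0)// ler_nat rlow_le_rup. Qed.
Let v0 : 0 < v. Proof. by rewrite invr_gt0. Qed.
Let nuq0 : 0 < nu ^+ 2. Proof. by rewrite exprn_gt0. Qed.

Let vD : v <= D.
Proof.
apply: (@le_trans _ _ (rlow r)%:R^-1).
  by rewrite lef_pV2 ?posrE// ler_nat rlow_le_rup.
rewrite /D invfM mulrA; apply: ler_peMl; first by rewrite invr_ge0 ltW.
by rewrite ler_pdivlMr// mul1r.
Qed.

Let Nv : 1 <= N * v.
Proof.
rewrite ler_pdivlMr// mul1r ler_nat; apply/bigmax_leqP => i _.
by case/andP: (rn i).
Qed.

Let b0 : 0 < b.
Proof. by rewrite mulr_gt0 ?divr_gt0//; move: N2 vD D2; lra. Qed.

(** The value 1 separates the two weights: [rup r <= n] gives both [b <= 1] and [1 <= N * v], and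
    [v <= D]. *)
Let b_le : b <= N * D.
Proof.
apply: (@le_trans _ _ 1); last first.
  by rewrite (le_trans Nv)// ler_wpM2l//; move: N2; lra.
rewrite /b mulrA ler_pdivrMr; last by move: N2; lra.
by move: Nv; lra.
Qed.

(** Divided by the squared mean of an entry of row [i], the weights become
    [N * delta / (nu ^+ 2 * r i)] and [(1 - 1 / r i) * N / (N - 1)]. The first decreases in [r i]
    and is largest at [rlow r]; the second increases and is largest at [rup r]. *)
Let weight_le i c :
  sqr_weight R n r nu delta i c
  <= ((r i)%:R / N * nu) ^+ 2 * (if c then N * D else b).
Proof.
have [r1 rin] := andP (rn i).
have ri0 : 0 < (r i)%:R :> R by rewrite ltr0n.
have Np : 0 < N by move: N2; lra.
have NB : 0 < N - 1 by move: N2; lra.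
rewrite /sqr_weight -/N; case: c.
  have -> : (r i)%:R / N * delta =
      ((r i)%:R / N * nu) ^+ 2 * (N * (delta / (nu ^+ 2 * (r i)%:R))).
    field; by rewrite !gt_eqF.
  apply: ler_wpM2l; first exact: sqr_ge0.
  apply: ler_wpM2l; first exact: ltW.
  apply: ler_wpM2l; first by rewrite (le_trans _ nud) ?sqr_ge0.
  by rewrite lef_pV2 ?posrE ?mulr_gt0// ler_pM2l// ler_nat rlow_le.
have -> : (r i)%:R * ((r i)%:R - 1) / (N * (N - 1)) * nu ^+ 2 =
    ((r i)%:R / N * nu) ^+ 2 * ((1 - (r i)%:R^-1) * (N / (N - 1))).
  by field; rewrite !gt_eqF.
apply: ler_wpM2l; first exact: sqr_ge0.
apply: ler_wpM2r; first by rewrite divr_ge0// ltW.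
by rewrite lerB// lef_pV2 ?posrE// ler_nat leq_bigmax.
Qed.

Let weight_ge0 i c : 0 <= sqr_weight R n r nu delta i c.
Proof.
have [r1 rin] := andP (rn i).
have NB : 0 <= N - 1 by move: N2; lra.
have d0 : 0 <= delta by rewrite (le_trans _ nud) ?sqr_ge0.
rewrite /sqr_weight; case: c; first by rewrite mulr_ge0 ?divr_ge0.
by rewrite mulr_ge0 ?sqr_ge0// divr_ge0// mulr_ge0// subr_ge0 ler1n.
Qed.

(* Only [t * s^-1] matters in the inner product, so the double sum is [n`!] times
   a sum over one permutation. *)
Lemma second_moment_le :
  \sum_(s : 'S_n) \sum_(t : 'S_n) \prod_i
    sqr_weight R n r nu delta i (s i == t i)
  <= mu_n r nu ^+ 2 *
     expR (N * (D - v) + 2 * N * D ^+ 2 + (N - 1)^-1).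
Proof.
set K := \prod_i ((r i)%:R / N * nu).
pose S := \sum_(s : 'S_n) \prod_i (if s i == i then N * D else b).
have Sle : S <= n`!%:R * expR (N * (D - v) + 2 * N * D ^+ 2 + (N - 1)^-1).
  rewrite (le_trans (sum_perm_fixed_points_le _ _ _ _ b0 b_le))//.
  by rewrite ler_wpM2l// weight_exp_bound.
apply: (@le_trans _ _ (n`!%:R * (K ^+ 2 * S))); last first.
  have -> : mu_n r nu = n`!%:R * K by rewrite mu_nE.
  set e := expR _ in Sle *.
  have -> : (n`!%:R * K) ^+ 2 * e = n`!%:R * (K ^+ 2 * (n`!%:R * e)) by ring.
  by rewrite ler_wpM2l// ler_wpM2l// sqr_ge0.
apply: (@le_trans _ _ (\sum_(s : 'S_n) K ^+ 2 * S)); last first.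
  by rewrite sumr_const -/(#|'S_n|) card_Sn mulr_natl.
apply: ler_sum => s _.
have -> : S = \sum_(t : 'S_n) \prod_i (if s i == t i then N * D else b).
  rewrite (reindex_inj (mulIg s)); apply: eq_bigr => t _; apply: eq_bigr => i _.
  by rewrite permM (inj_eq perm_inj) eq_sym.
rewrite mulr_sumr; apply: ler_sum => t _.
rewrite /K -prodrXl -big_split/=; apply: ler_prod => i _.
by rewrite weight_ge0 weight_le.
Qed.

End SecondMomentBound.

(** * Almost surely positive entries *)

Lemma ae_of_prob1 (d : measure_display) (T : measurableType d) (R : realType)
  (P : probability T R) (E : set T) :
  measurable E -> P E = 1%E -> {ae P, forall w, E w}.
Proof.
move=> mE PE; exists (~` E); split=> //; first exact: measurableC.
by rewrite probability_setC// PE subee.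
Qed.

Lemma ae_forall_fin (d : measure_display) (T : measurableType d) (R : realType)
  (P : probability T R) (I : finType) (Q : I -> T -> Prop) :
  (forall i, {ae P, forall w, Q i w}) -> {ae P, forall w, forall i, Q i w}.
Proof.
move=> aeQ.
(* The finite family is enumerated as a sequence, padded with [True] beyond the last index. *)
have := @ae_foralln _ _ _ P (fun k w =>
  if (insub k : option 'I_#|I|) is Some o then Q (enum_val o) w else True) _.
case=> [k|B [mB PB BQ]]; first by case: insub => [u|]; [exact: aeQ|exact: aeW].
exists B; split=> // w nQ; apply: BQ => h; apply: nQ => i.
by have := h (enum_rank i); rewrite valK enum_rankK.
Qed.

(* The entries are positive only almost surely, so the non-negative theory is
   applied to their absolute values. *)
Section PositiveEntries.
Context (d : measure_display) (T : measurableType d) (R : realType)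
  (P : probability T R) (n : nat) (Z : 'I_n -> 'I_n -> {RV P >-> R})
  (nu delta : R).
Hypothesis Zindep :
  mutually_independent P (fun ij : 'I_n * 'I_n => (Z ij.1 ij.2 : T -> R)).
Hypothesis Zpos : forall i j, P [set w | 0 < Z i j w] = 1%E.
Hypothesis EZ : forall i j, (\int[P]_w (Z i j w)%:E = nu%:E)%E.
Hypothesis EZ2 : forall i j, (\int[P]_w ((Z i j w) ^+ 2)%:E = delta%:E)%E.

Let A (i j : 'I_n) (w : T) : R := `|Z i j w|.

Let mZ i j : measurable_fun setT (Z i j). Proof. exact: measurable_funPT. Qed.

Let mA i j : measurable_fun setT (A i j).
Proof. exact: measurableT_comp. Qed.

Let aeZ i j : {ae P, forall w, 0 < Z i j w}.
Proof.
apply: (ae_of_prob1 _ _ _ P [set w | 0 < Z i j w]) => //.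
have -> : [set w | 0 < Z i j w] = setT `&` Z i j @^-1` `]0, +oo[%classic.
  by apply/seteqP; split=> w /=; rewrite in_itv/= andbT => // -[].
by apply: mZ => //; exact: measurable_itv.
Qed.

Let aeA : {ae P, forall w, forall i j, A i j w = Z i j w}.
Proof.
have := ae_forall_fin _ _ _ P _ (fun (ij : 'I_n * 'I_n) w => 0 < Z ij.1 ij.2 w)
  (fun ij => aeZ ij.1 ij.2).
apply: filterS => w h i j; rewrite /A gtr0_norm//; exact: (h (i, j)).
Qed.

Let EA i j : (\int[P]_w (A i j w)%:E = nu%:E)%E.
Proof.
rewrite -(EZ i j); apply: ae_eq_integral => //; [exact/measurable_EFinP..|].
by apply: filterS aeA => w h _; rewrite h.
Qed.

Let EA2 i j : (\int[P]_w (A i j w ^+ 2)%:E = delta%:E)%E.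
Proof.
by rewrite -(EZ2 i j); apply: eq_integral => w _; rewrite /A real_normK// num_real.
Qed.

(** A zero mean of the absolute value would force the entry to vanish almost surely, against its
    almost sure positivity on a space of mass 1. *)
Lemma mean_gt0 : (0 < n)%N -> 0 < nu.
Proof.
move=> n0; pose i := Ordinal n0.
have nu_ge0 : 0 <= nu.
  rewrite -lee_fin -(EA i i); apply: integral_ge0 => w _.
  by rewrite lee_fin normr_ge0.
rewrite lt_neqAle nu_ge0 andbT; apply/eqP => nu0.
have mE : measurable_fun setT (EFin \o Z i i) by exact/measurable_EFinP.
have := (ae_eq_integral_abs P measurableT mE).1.
have -> : (\int[P]_w `|(EFin \o Z i i) w| = 0)%E.
  by transitivity nu%:E; [exact: EA|rewrite -nu0].
move=> /(_ erefl) Z0.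
have Ppos : (0 < P setT)%E by rewrite probability_setT.
have PF : ProperFilter (almost_everywhere P).
  exact: (ae_properfilter_algebraOfSetsType Ppos).
have : {ae P, forall w, False}.
  apply: filterS2 Z0 (aeZ i i) => w /(_ I) /= [Zw].
  by rewrite Zw ltxx.
by apply: filter_not_empty.
Qed.

(** Integrates [2 * nu * A <= A ^+ 2 + nu ^+ 2], the square of [A - nu] rearranged so that both
    sides are non-negative. *)
Lemma sqr_mean_le : (0 < n)%N -> nu ^+ 2 <= delta.
Proof.
move=> n0; pose i := Ordinal n0; have nup := mean_gt0 n0.
have k0 : 0 <= 2 * nu by rewrite mulr_ge0// ltW.
have : (\int[P]_w ((2 * nu)%:E * (A i i w)%:E)
    <= \int[P]_w ((A i i w ^+ 2)%:E + (nu ^+ 2)%:E))%E.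
  apply: ge0_le_integral => //.
  - by move=> w _; rewrite -EFinM lee_fin mulr_ge0// normr_ge0.
  - by apply: measurable_funeM; exact/measurable_EFinP.
  - apply: emeasurable_funD => //; apply/measurable_EFinP.
    exact: measurable_funX.
  - move=> w _; rewrite -EFinM -EFinD lee_fin -subr_ge0.
    have -> : A i i w ^+ 2 + nu ^+ 2 - 2 * nu * A i i w = (A i i w - nu) ^+ 2.
      by ring.
    exact: sqr_ge0.
rewrite ge0_integralZl_EFin//; last 2 first.
- by move=> w _; rewrite lee_fin normr_ge0.
- exact/measurable_EFinP.
rewrite ge0_integralD//; last 3 first.
- by move=> w _; rewrite lee_fin sqr_ge0.
- by apply/measurable_EFinP; exact: measurable_funX.
- by move=> w _; rewrite lee_fin sqr_ge0.
rewrite EA EA2 integral_cst//= probability_setT mule1 -EFinM -EFinD lee_fin.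
by move=> h; nra.
Qed.

Let momA (e : 'I_n -> 'I_n -> nat) : (forall i j, (e i j <= 2)%N) ->
  (\int[P]_w (\prod_i \prod_j A i j w ^+ e i j)%:E
   = (\prod_i \prod_j nth delta [:: 1; nu] (e i j))%:E)%E.
Proof.
move=> e2.
(* The absolute value is absorbed into the test function, so independence of the [Z i j] themselves
   suffices. *)
pose f (ij : 'I_n * 'I_n) (x : R) := `|x| ^+ e ij.1 ij.2.
have intf ij : (\int[P]_w (f ij (Z ij.1 ij.2 w))%:E
    = (nth delta [:: 1; nu] (e ij.1 ij.2))%:E)%E.
  rewrite /f; case: ij => i j /=; have := e2 i j.
  case: (e i j) => [|[|[|]]]//= _.
  - under eq_integral do rewrite expr0.
    by rewrite integral_cst//= probability_setT mule1.
  - by rewrite -(EA i j); apply: eq_integral => w _; rewrite expr1.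
  - exact: EA2.
rewrite pair_bigA/= -prodEFin.
rewrite -(eq_bigr _ (fun ij _ => intf ij)) -integral_prod_indep//.
- by apply: eq_integral => w _; rewrite pair_bigA.
- by move=> ij; apply: measurable_funX; exact: normr_measurable.
- by move=> ij x; rewrite exprn_ge0.
- by move=> ij; rewrite intf ltry.
Qed.

Variable r : 'I_n -> nat.
Hypothesis rn : forall i, (1 <= r i <= n)%N.

Let perZ (x : 'M[bool]_n) (w : T) : R :=
  per (hadamard01 x (\matrix_(i, j) Z i j w)).
Let perA (x : 'M[bool]_n) (w : T) : R :=
  per (hadamard01 x (\matrix_(i, j) A i j w)).

Let EXZ_abs (g : R -> R) : measurable_fun setT g ->
  EXZ P r (fun x w => g (perZ x w)) = EXZ P r (fun x w => g (perA x w)).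
Proof.
move=> mg; rewrite /EXZ; congr (_ * _)%E; apply: eq_bigr => x _.
have mp (B : 'I_n -> 'I_n -> T -> R) : (forall i j, measurable_fun setT (B i j)) ->
    measurable_fun setT
      (fun w => (g (per (hadamard01 x (\matrix_(i, j) B i j w))))%:E).
  move=> mB; apply/measurable_EFinP; apply: (measurableT_comp mg).
  exact: measurable_per.
apply: ae_eq_integral => //; [exact: (mp (fun i j => Z i j))|exact: mp|].
apply: filterS aeA => w h _; congr (g (per (hadamard01 x _)))%:E.
by apply/matrixP => i j; rewrite !mxE h.
Qed.

Lemma EXZ_per : EXZ P r perZ = (mu_n r nu)%:E.
Proof.
rewrite (EXZ_abs id)//.
apply: (expectation_per _ _ _ P _ _ rn A nu delta) => //.
by move=> i j w; rewrite normr_ge0.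
Qed.

Lemma EXZ_normalized_per_le : (2 <= n)%N ->
  let D := delta / (nu ^+ 2 * (rlow r)%:R) in
  D <= 1 / 2 ->
  (0 <= EXZ P r (fun x w => ((perZ x w / mu_n r nu - 1) ^+ 2)%R)
     <= (expR (n%:R * (D - (rup r)%:R^-1) + 2 * n%:R * D ^+ 2
               + (n%:R - 1)^-1) - 1)%R%:E)%E.
Proof.
move=> n2 D D2; have n0 : (0 < n)%N by exact: leq_trans n2.
have nup := mean_gt0 n0.
have mup : 0 < mu_n r nu.
  rewrite mu_nE mulr_gt0 ?ltr0n ?fact_gt0//; apply: prodr_gt0 => i _.
  by rewrite mulr_gt0// divr_gt0// ltr0n//; case/andP: (rn i).
apply/andP; split.
  apply: mule_ge0; first by rewrite lee_fin invr_ge0.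
  by apply: sume_ge0 => x _; apply: integral_ge0 => w _; rewrite lee_fin sqr_ge0.
rewrite (EXZ_abs (fun t => (t / mu_n r nu - 1) ^+ 2)); last first.
  apply: measurable_funX; apply: measurable_funB => //.
  exact: measurable_funM.
rewrite (expectation_normalized_per _ _ _ P _ _ rn A nu delta)//; last first.
  by move=> i j w; rewrite normr_ge0.
rewrite lee_fin lerD2r ler_pdivrMr ?exprn_gt0// mulrC.
by apply: second_moment_le => //; exact: sqr_mean_le.
Qed.

End PositiveEntries.

(** * Passage to the limit in the second moment bound *)

Theorem theorem1 (R : realType) (d : measure_display)
  (T : nat -> measurableType d) (P : forall n, probability (T n) R)
  (Z : forall n, 'I_n -> 'I_n -> {RV (P n) >-> R})
  (nu delta : nat -> R) (r : forall n, 'I_n -> nat) :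
  (forall n, mutually_independent (P n) (fun ij : 'I_n * 'I_n => (Z n ij.1 ij.2 : T n -> R))) ->
  (forall n, identically_distributed (P n) (fun ij : 'I_n * 'I_n => (Z n ij.1 ij.2 : T n -> R))) ->
  (forall n i j, P n [set w | 0 < Z n i j w] = 1%E) ->
  (forall n i j, (\int[P n]_w (Z n i j w)%:E = (nu n)%:E)%E) ->
  (forall n i j, (\int[P n]_w ((Z n i j w) ^+ 2)%:E = (delta n)%:E)%E) ->
  (forall n i, (1 <= r n i <= n)%N) ->
  (forall n, (1 <= n)%N ->
     EXZ (P n) (r n) (fun x w => per (hadamard01 x (\matrix_(i, j) Z n i j w)))
     = (mu_n (r n) (nu n))%:E)
  /\
  ((fun n : nat => Num.sqrt (n%:R : R) * (delta n / (nu n ^+ 2 * (rlow (r n))%:R)))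
       @ \oo --> (0 : R) ->
   (fun n : nat => n%:R * (delta n / (nu n ^+ 2 * (rlow (r n))%:R)
                            - ((rup (r n))%:R)^-1)) @ \oo --> (0 : R) ->
   (fun n : nat =>
      EXZ (P n) (r n) (fun x w =>
        (per (hadamard01 x (\matrix_(i, j) Z n i j w)) / mu_n (r n) (nu n) - 1) ^+ 2))
     @ \oo --> (0 : \bar R)).
Proof.
move=> indep _ pos EZ EZ2 rn; split.
  by move=> n n1; exact: (EXZ_per _ _ _ _ _ _ _ _ (indep n) (pos n) (EZ n) (EZ2 n)).
pose D n := delta n / (nu n ^+ 2 * (rlow (r n))%:R).
move=> sqrtD nD.
pose eps (n : nat) : R := n%:R * (D n - (rup (r n))%:R^-1) +
  2 * n%:R * D n ^+ 2 + (n%:R - 1)^-1.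
have eps0 : eps @ \oo --> (0 : R).
  have sq : (fun n : nat => 2 * n%:R * D n ^+ 2) @ \oo --> (0 : R).
    (* The quadratic term is twice the square of the sequence in the first hypothesis. *)
    have -> : (fun n : nat => 2 * n%:R * D n ^+ 2) =
        (fun n : nat => 2 * ((Num.sqrt (n%:R : R) * D n) *
                             (Num.sqrt (n%:R : R) * D n))).
      by apply/funext => n; rewrite -[in RHS]expr2 [in RHS]exprMn sqr_sqrtr// [RHS]mulrA.
    by have := cvgM (cvg_cst (2 : R)) (cvgM sqrtD sqrtD); rewrite !mulr0; apply.
  have harm : (fun n : nat => (n%:R - 1)^-1) @ \oo --> (0 : R).
    (* Shifting by two turns [1 / (n - 1)] into [1 / (n + 1)], the harmonic sequence indexed from 0,
       and skips the degenerate index [n = 1]. *)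
    rewrite -cvg_shiftS -cvg_shiftS.
    have -> : (fun n : nat => (n.+2%:R - 1)^-1) = (@harmonic R).
      by apply/funext => n /=; rewrite -[n.+2]addn1 natrD addrK.
    exact: cvg_harmonic.
  by have := cvgD (cvgD nD sq) harm; rewrite !addr0; apply.
have bound0 : (fun n => (expR (eps n) - 1)%:E) @ \oo --> (0 : \bar R).
  apply: cvg_EFin; first by near=> n.
  have := cvgB (continuous_cvg _ (@continuous_expR R 0) eps0) (cvg_cst (1 : R)).
  by rewrite expR0 subrr; apply.
apply: (squeeze_cvge _ (cvg_cst _) bound0).
(* The bound for fixed [n] requires [D n <= 1 / 2]. This follows eventually from the first
   hypothesis, as [D n] is non-negative and hence at most [sqrt n * D n] for [n >= 1]. *)
have small : \forall n \near \oo, Num.sqrt (n%:R : R) * D n <= 1 / 2.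
  by apply: (cvgr_le _ sqrtD); rewrite divr_gt0.
near=> n.
have sn : Num.sqrt (n%:R : R) * D n <= 1 / 2 by near: n; exact: small.
have n2 : (2 <= n)%N by near: n; exact: nbhs_infty_ge.
have n0 : (0 < n)%N by exact: leq_trans n2.
apply: (EXZ_normalized_per_le _ _ _ _ _ _ _ _ (indep n) (pos n) (EZ n) (EZ2 n) _ (rn n)) => //.
have D0 : 0 <= D n.
  apply: divr_ge0; last by apply: mulr_ge0; [exact: sqr_ge0|exact: ler0n].
  have := sqr_mean_le _ _ _ _ _ _ _ _ (pos n) (EZ n) (EZ2 n) n0.
  by apply: le_trans; exact: sqr_ge0.
apply: (@le_trans _ _ (Num.sqrt (n%:R : R) * D n)) => //.
apply: ler_peMl; first exact: D0.
by rewrite -[X in X <= _]sqrtr1 ler_sqrt ?ltr0n// ler1n.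
Unshelve. all: by end_near. Qed.
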